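(* Let $I \subseteq [k]$ with $1\leq |I|\leq k-1$, and let $T$ be a $k$-tensor. If $|\mathbb{F}| > R_I(T)$, then \[ \prod_{\substack{i \in I\\ j \in [k]\setminus I}} Q_{i,j}(T) \geq R_I(T). \]
   Context: $T\in V_1\otimes\cdots\otimes V_k$ is a $k$-tensor over a field $\mathbb{F}$. $S\le T$ (restriction) means $S=(A_1\otimes\cdots\otimes A_k)T$ for some linear maps $A_i$. For $i\neq j\in[k]$ and $r\in\mathbb{N}$, $\langle r\rangle_{i,j}$ is the $k$-tensor $\sum_{\ell=1}^r$ of tensor products with $e_\ell$ in legs $i$ and $j$ and $e_1$ in all other legs; $Q_{i,j}(T)$ is the largest $r$ with $T\geq\langle r\rangle_{i,j}$. $R_I(T)$ is the flattening rank: the matrix rank of the matrix obtained from $T$ by grouping the legs in $I$ together and the legs in $[k]\setminus I$ together. *)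

(* Defs.v *)
From HB Require Import structures.
From mathcomp Require Import all_boot all_order all_algebra.
From mathcomp Require Import boolp classical_sets functions cardinality.

Set Implicit Arguments.
Unset Strict Implicit.
Unset Printing Implicit Defensive.

Import GRing.Theory.
Local Open Scope ring_scope.

(* After choosing bases, V_i = F^(n i), and a k-tensor in V_1 (x) ... (x) V_k
   is its family of coordinates, indexed by the multi-indices x with
   x i : 'I_(n i). *)
Definition midx (k : nat) (n : 'I_k -> nat) := {dffun forall i : 'I_k, 'I_(n i)}.

Definition tensor (F : fieldType) (k : nat) (n : 'I_k -> nat) :=
  {ffun midx n -> F}.

Definition tpure (F : fieldType) (k : nat) (n : 'I_k -> nat)
    (v : forall i : 'I_k, 'cV[F]_(n i)) : tensor F n :=
  [ffun x : midx n => \prod_(i < k) v i (x i) 0].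

(* (A_1 (x) ... (x) A_k) T; see tmap_pure and tmap_is_linear below. *)
Definition tmap (F : fieldType) (k : nat) (m n : 'I_k -> nat)
    (A : forall i : 'I_k, 'M[F]_(m i, n i)) (T : tensor F n) : tensor F m :=
  [ffun y : midx m => \sum_(x : midx n) (\prod_(i < k) A i (y i) (x i)) * T x].

(* S <= T; the two tensors need not have the same format. *)
Definition restriction (F : fieldType) (k : nat) (m n : 'I_k -> nat)
    (S : tensor F m) (T : tensor F n) : Prop :=
  exists A : forall i : 'I_k, 'M[F]_(m i, n i), S = tmap A T.

(* The standard basis vectors, numbered from 0, so that e_1 is evec _ _ 0. *)
Definition evec (F : fieldType) (d a : nat) : 'cV[F]_d :=
  \col_(b < d) ((b : nat) == a)%:R.

(* <r>_{i,j} lives in the smallest possible format: F^r in the legs i and j,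
   F^1 in the others. *)
Definition pair_dim (k : nat) (i j : 'I_k) (r : nat) (l : 'I_k) : nat :=
  if (l == i) || (l == j) then r else 1%N.

Definition pair_tensor (F : fieldType) (k : nat) (i j : 'I_k) (r : nat) :
    tensor F (pair_dim i j r) :=
  \sum_(a < r) tpure (fun l : 'I_k =>
    evec F (pair_dim i j r l) (if (l == i) || (l == j) then a : nat else 0%N)).

Definition is_subrank (F : fieldType) (k : nat) (n : 'I_k -> nat)
    (i j : 'I_k) (T : tensor F n) (r : nat) : Prop :=
  restriction (pair_tensor F i j r) T /\
  forall s : nat, restriction (pair_tensor F i j s) T -> (s <= r)%N.

(* Q_{i,j}(T). For i != j the maximum exists (subrankP), so that the default
   value 0 of xget is not used. *)
Definition subrank (F : fieldType) (k : nat) (n : 'I_k -> nat)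
    (i j : 'I_k) (T : tensor F n) : nat :=
  xget 0%N (is_subrank i j T : set nat).

Definition pidx (k : nat) (n : 'I_k -> nat) (I : {set 'I_k}) :=
  {dffun forall i : {i : 'I_k | i \in I}, 'I_(n (val i))}.

Lemma in_or_inC (k : nat) (I : {set 'I_k}) (i : 'I_k) :
  {i \in I} + {i \in ~: I}.
Proof. by rewrite finset.in_setC; case: (i \in I); [left|right]. Qed.

Definition merge_idx (k : nat) (n : 'I_k -> nat) (I : {set 'I_k})
    (u : pidx n I) (v : pidx n (~: I)) : midx n :=
  [ffun i : 'I_k => match in_or_inC I i with
     | left iI => u (exist _ i iI)
     | right iI => v (exist _ i iI)
     end].

Definition flattening (F : fieldType) (k : nat) (n : 'I_k -> nat)
    (I : {set 'I_k}) (T : tensor F n) : 'M[F]_(#|pidx n I|, #|pidx n (~: I)|) :=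
  \matrix_(a, b) T (merge_idx (enum_val a) (enum_val b)).

Definition flattening_rank (F : fieldType) (k : nat) (n : 'I_k -> nat)
    (I : {set 'I_k}) (T : tensor F n) : nat :=
  \rank (flattening I T).

Lemma merge_idx_in (k : nat) (n : 'I_k -> nat) (I : {set 'I_k})
    (u : pidx n I) (v : pidx n (~: I)) (i : {i : 'I_k | i \in I}) :
  merge_idx u v (val i) = u i.
Proof.
case: i => i iI; rewrite ffunE /=; case: in_or_inC => iI'.
  by rewrite (bool_irrelevance iI' iI).
by exfalso; move: iI'; rewrite inE iI.
Qed.

Lemma merge_idx_notin (k : nat) (n : 'I_k -> nat) (I : {set 'I_k})
    (u : pidx n I) (v : pidx n (~: I)) (i : {i : 'I_k | i \in ~: I}) :
  merge_idx u v (val i) = v i.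
Proof.
case: i => i iI; rewrite ffunE /=; case: in_or_inC => iI'.
  by exfalso; move: iI; rewrite inE iI'.
by rewrite (bool_irrelevance iI' iI).
Qed.

Lemma tmap_is_linear (F : fieldType) (k : nat) (m n : 'I_k -> nat)
    (A : forall i : 'I_k, 'M[F]_(m i, n i)) (c : F) (S T : tensor F n) :
  tmap A [ffun x => c * S x + T x] = [ffun y => c * tmap A S y + tmap A T y].
Proof.
apply/ffunP => y; rewrite !ffunE mulr_sumr -big_split /=.
by apply: eq_bigr => x _; rewrite !ffunE mulrDr mulrCA.
Qed.

Lemma tmap_pure (F : fieldType) (k : nat) (m n : 'I_k -> nat)
    (A : forall i : 'I_k, 'M[F]_(m i, n i))
    (v : forall i : 'I_k, 'cV[F]_(n i)) :
  tmap A (tpure v) = tpure (fun i => A i *m v i).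
Proof.
apply/ffunP => y; rewrite !ffunE.
pose P_ i := [ffun x : 'I_(n i) => A i (y i) x * v i x 0].
transitivity (\sum_(x : midx n) \prod_(i < k) P_ i (x i)).
  by apply: eq_bigr => x _; rewrite ffunE -big_split; apply: eq_bigr => i _;
    rewrite ffunE.
rewrite (reindex _ (onW_bij _ (@dffun_of_fprod_bij _ (fun i => 'I_(n i))))) /=.
transitivity (\sum_(t : fprod (fun i => 'I_(n i))) \prod_(i in 'I_k) P_ i (t i)).
  by apply: eq_bigr => t _; apply: eq_big => [i|i _]; rewrite ?inE ?ffunE.
rewrite big_fprod -(bigA_distr_big_dep
  (fun i => tagged_with (fun i => 'I_(n i)) i) (fun i => untag 0 (P_ i))).
apply: eq_bigr => i _; rewrite !mxE -(big_tag (fun i j => P_ i j)).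
by apply: eq_bigr => j _; rewrite ffunE.
Qed.

Lemma restriction_pair_tensor0 (F : fieldType) (k : nat) (n : 'I_k -> nat)
    (i j : 'I_k) (T : tensor F n) : restriction (pair_tensor F i j 0) T.
Proof.
exists (fun=> 0); apply/ffunP => y; have := y i.
by rewrite /pair_dim eqxx; case.
Qed.

Lemma restriction_pair_tensor_leq (F : fieldType) (k : nat) (n : 'I_k -> nat)
    (i j : 'I_k) (T : tensor F n) (r : nat) :
  i != j -> restriction (pair_tensor F i j r) T -> (r <= n i)%N.
Proof.
case: r => // r ij [A eA].
have d_gt0 l : (0 < pair_dim i j r.+1 l)%N by rewrite /pair_dim; case: ifP.
pose el l a : 'I_(pair_dim i j r.+1 l) := Ordinal (ltn_pmod a (d_gt0 l)).
pose idx (a b : nat) : midx (pair_dim i j r.+1) :=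
  [ffun l => el l (if l == i then a else if l == j then b else 0%N)].
pose B := \matrix_(a < r.+1, c < n i) A i (el i a) c.
pose C := \matrix_(c < n i, b < r.+1) \sum_(x : midx n | x i == c)
   (\prod_(l < k | l != i) A l (idx 0 b l) (x l)) * T x.
suff BC : B *m C = 1%:M.
  by rewrite -(mxrank1 F r.+1) -BC (leq_trans (mxrankM_maxl _ _)) ?rank_leq_col.
apply/matrixP => a b.
have: pair_tensor F i j r.+1 (idx a b) = (a == b)%:R.
  rewrite /pair_tensor sum_ffunE (bigD1 a) //= big1 ?addr0; last first.
    move=> c ca; rewrite ffunE (bigD1 i) //= mxE ffunE eqxx /=.
    have ac : ((a : nat) == c) = false by apply/negbTE; rewrite eq_sym.
    by rewrite /pair_dim eqxx modn_small // ac mul0r.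
  rewrite ffunE (bigD1 i) //= (bigD1 j) 1?eq_sym //= big1 ?mulr1.
    rewrite !mxE !ffunE !eqxx (eq_sym j) (negPf ij) orbT /=.
    by rewrite /pair_dim !eqxx orbT /= !modn_small // eqxx mul1r eq_sym.
  move=> l /andP[li lj]; rewrite mxE ffunE (negPf li) (negPf lj) /=.
  by rewrite mod0n.
rewrite eA ffunE !mxE => <-.
rewrite (partition_big (fun x : midx n => x i) xpredT) //=.
apply: eq_bigr => c _; rewrite !mxE mulr_sumr; apply: eq_bigr => x /eqP xc.
rewrite [in RHS](bigD1 i) //= -mulrA ffunE eqxx xc; congr (_ * (_ * _)).
by apply: eq_bigr => l li; rewrite !ffunE (negPf li).
Qed.

Lemma subrankP (F : fieldType) (k : nat) (n : 'I_k -> nat)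
    (i j : 'I_k) (T : tensor F n) :
  i != j -> is_subrank i j T (subrank i j T).
Proof.
move=> ij; apply: (@xgetPex _ _ (is_subrank i j T : set nat)).
pose P r := `[< restriction (pair_tensor F i j r) T >].
have exP : exists r, P r.
  by exists 0%N; apply/asboolP/restriction_pair_tensor0.
have ubP r : P r -> (r <= n i)%N.
  by move/asboolP; apply: restriction_pair_tensor_leq.
case: (ex_maxnP exP ubP) => r /asboolP rT r_max.
by exists r; split=> // s sT; apply: r_max; apply/asboolP.
Qed.

(* Main.v *)
(* Write R_P,Q(S) for the rank of the flattening P vs Q of a tensor S from
   which all other legs have been contracted with vectors. The theorem follows
   by splitting off one leg at a time, first from the complement of I and then
   from I, using the following inequality. Let S be a tensor with legs U, W, V,
   let r be the largest rank (U vs W) of a contraction of V with a vector, and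
   let q bound the rank (U vs V) of the contractions of W with standard basis
   vectors. Then R_U(S) <= r q, provided that the field is large enough.

   For the proof, let A = S(v) have maximal rank r and let K be the left kernel
   of A. Perturbing A to A + t A' for another slice A' shows that K maps the
   rows of every slice into the row space of A. That space is detected by r
   columns b, so that R_U(S) <= r + sum_b rank (K B_b), where B_b is S
   contracted with b in W. Finally B_b v is the b-th column of A, which is
   nonzero and killed by K, whence rank (K B_b) <= q - 1.

   As b is a standard basis vector of W, it is a product vector when W groups
   several legs; this is what makes the induction on legs possible. *)
Require Import Defs.
From mathcomp Require Import all_boot all_order all_algebra.
From mathcomp Require Import zify.
From mathcomp Require Import boolp classical_sets functions cardinality.

Set Implicit Arguments.
Unset Strict Implicit.
Unset Printing Implicit Defensive.
Import GRing.Theory.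
Local Open Scope ring_scope.

(** * Ranks of matrix pencils and of slices *)

(* If u A = 0 and u B is not in the row space of A, then after cutting down to
   rank A + 1 rows and columns every field element, including 0, is an
   eigenvalue of one matrix C of size rank A + 1. *)
Lemma kermx_pencil_sub (F : fieldType) (m N : nat) (A B : 'M[F]_(m, N))
    (s : seq F) :
  uniq s -> ((\rank A).+1 < size s)%N ->
  (forall t, \rank (A + t *: B)%R <= \rank A)%N ->
  (kermx A *m B <= A)%MS.
Proof.
move=> s_uniq lt_s rkAB; apply/row_subP => i; rewrite row_mul.
set u := row i _; have uA : u *m A = 0 by apply/sub_kermxP/row_sub.
case: (boolP (u *m B <= A)%MS) => // uB.
pose L := row_base A *m pinvmx A.
have LA : L *m A = row_base A by rewrite mulmxKpV ?eq_row_base.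
have /row_freeP[R]: row_free (col_mx (L *m A) (u *m B)).
  rewrite LA /row_free eqn_leq rank_leq_row [X in (X <= _)%N]addn1.
  rewrite (leq_ltn_trans (_ : _ <= \rank (row_base A))%N) //.
    by rewrite (eqP (row_base_free A)).
  rewrite rank_ltmx // ltmxE -!addsmxE addsmxSl addsmx_sub submx_refl /=.
  by rewrite eq_row_base.
rewrite mul_col_mx => LuR.
(* For nonzero [t], [1 - t^-1 *: C] factors through [A - t^-1 *: B], of rank at most [\rank A], so
   it is singular and [t] is an eigenvalue of [C]; the zero row of [C] accounts for [t = 0]. *)
pose C := col_mx (L *m B *m R) (0 : 'M_(1, _)).
have rootC t : root (char_poly C) t.
  rewrite -eigenvalue_root_char.
  have [->|t0] := eqVneq t 0.
    apply/eigenvalueP; exists (row_mx 0 1%:M).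
      by rewrite mul_row_col mul0mx mul1mx addr0 scale0r.
    by rewrite row_mx_eq0 negb_and orbC oner_neq0.
  suff: ~~ row_free (1%:M - t^-1 *: C).
    rewrite -kermx_eq0 => /rowV0Pn[v /sub_kermxP].
    rewrite mulmxBr mulmx1 -scalemxAr => /eqP; rewrite subr_eq0 => /eqP vC v0.
    by apply/eigenvalueP; exists v; rewrite // {2}vC scalerA mulfV ?scale1r.
  have -> : 1%:M - t^-1 *: C
    = col_mx (L *m (A - t^-1 *: B)) (- t *: (u *m (A - t^-1 *: B))) *m R.
    rewrite -LuR mul_col_mx scale_col_mx opp_col_mx add_col_mx scaler0 oppr0.
    rewrite addr0 !mulmxBr uA !mulmxBl -!scalemxAr sub0r scalerN scaleNr opprK.
    by rewrite scalerA mulfV ?scale1r // !scalemxAl.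
  rewrite /row_free neq_ltn (leq_ltn_trans (mxrankM_maxl _ _)) //.
  rewrite [X in (_ < X)%N]addn1 ltnS -scaleNr.
  apply: leq_trans (rkAB (- t^-1)).
  apply: mxrankS; rewrite -addsmxE addsmx_sub; apply/andP; split.
    exact: submxMl.
  exact/scalemx_sub/submxMl.
have allC : all (root (char_poly C)) s by apply/allP => t _; apply: rootC.
have := max_poly_roots (monic_neq0 (char_poly_monic C)) allC s_uniq.
by rewrite size_char_poly ltnS leqNgt [X in (X < _)%N]addn1 lt_s.
Qed.

Lemma mxrank_sum_le (F : fieldType) (m n r q : nat) (A : 'I_r -> 'M[F]_(m, n)) :
  (forall i, \rank (A i) <= q)%N -> (\rank (\sum_i A i)%R <= r * q)%N.
Proof.
move=> Aq; rewrite -[r in X in (_ <= X)%N]card_ord -sum_nat_const.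
elim/big_ind2: _ => [|x1 x2 y1 y2 le1 le2|i _]; rewrite ?mxrank0 //.
exact: leq_trans (mxrank_add _ _) (leq_add le1 le2).
Qed.

(* [X] consists of columns of the slices [A l], tagged by [c] and [s]. *)
Lemma mxrank_slices (F : fieldType) (m N d p : nat) (A : 'I_d -> 'M[F]_(m, N))
    (X : 'M[F]_(m, p)) (c : 'I_p -> 'I_d) (s : 'I_p -> 'I_N) (r q : nat)
    (e : seq F) :
  (forall i b, X i b = A (c b) i (s b)) ->
  (forall v : 'I_d -> F, \rank (\sum_l v l *: A l)%R <= r)%N ->
  (forall b, \rank (\matrix_(i, l) A l i b)%R <= q)%N ->
  uniq e -> (\rank X < size e)%N ->
  (\rank X <= r * q)%N.
Proof.
move=> XE Ar Bq e_uniq lt_e.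
pose S (v : 'I_d -> F) := \sum_l v l *: A l.
pose B b := \matrix_(i, l) A l i b.
pose P k := `[< exists v, \rank (S v) = k >].
have exP : exists k, P k.
  by exists (\rank (S (fun=> 0))); apply/asboolP; exists (fun=> 0).
have ubP k : P k -> (k <= m)%N by move=> /asboolP[v <-]; apply: rank_leq_row.
case: (ex_maxnP exP ubP) => r0 /asboolP[v vr0] r0_max {exP ubP}.
have rkS w : (\rank (S w) <= r0)%N by apply: r0_max; apply/asboolP; exists w.
apply: leq_trans (_ : r0 * q <= _)%N; last first.
  by rewrite leq_mul2r -vr0 Ar orbT.
have [q0|q0] := posnP q.
  rewrite q0 muln0 leqn0 mxrank_eq0; apply/eqP/matrixP => i b; rewrite XE !mxE.
  have := Bq (s b); rewrite q0 leqn0 mxrank_eq0 => /eqP/matrixP/(_ i (c b)).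
  by rewrite !mxE.
(* Past this case [r0 + 1 <= \rank X < size e], as the pencil argument requires. *)
have [rkX|rkX] := leqP (\rank X) r0.
  by rewrite (leq_trans rkX) // leq_pmulr.
pose K := kermx (S v).
have KA l : (K *m A l <= S v)%MS.
  apply: (kermx_pencil_sub e_uniq).
    by rewrite vr0; apply: leq_trans lt_e.
  move=> t; rewrite vr0; have := rkS (fun j => v j + (if j == l then t else 0)).
  rewrite /S (eq_bigr (fun j => v j *: A j + (if j == l then t *: A l else 0))).
    by rewrite big_split -big_mkcond big_pred1_eq.
  by move=> j _; rewrite scalerDl; case: eqP => [->|]; rewrite ?scale0r.
have rkKX : (\rank X <= r0 + \rank (K *m X)%R)%N.
  have := mxrank_mul_min K X; rewrite mxrank_ker vr0.
  have : (r0 <= m)%N by rewrite -vr0 rank_leq_row.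
  lia.
apply: leq_trans rkKX _.
have -> : (r0 * q = r0 + r0 * q.-1)%N by rewrite -mulnS prednK.
rewrite leq_add2l.
(* The columns [f] of [S v] span its column space, with coefficients [D]. The rows of [K *m A l] lie
   in the row space of [S v], so the same [D] serves for them. *)
pose f := maxrankfun (S v)^T.
have /submxP[D vD] : ((S v)^T <= rowsub f (S v)^T)%MS by rewrite eq_maxrowsub.
have KAE l : K *m A l = colsub f (K *m A l) *m D^T.
  have /submxP[Y ->] := KA l.
  rewrite -mulmx_colsub -mulmxA; congr (_ *m _); apply: trmx_inj.
  by rewrite [LHS]vD trmx_mul trmxK trmx_mxsub.
(* Collecting by [a] puts the columns [f a] of all slices together into [B (f a)]. *)
pose Y a := \matrix_(l, b) ((l == c b)%:R * D (s b) a).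
have -> : K *m X = \sum_a (K *m B (f a)) *m Y a.
  apply/matrixP => i b; rewrite summxE.
  have -> : (K *m X) i b = (K *m A (c b)) i (s b).
    by rewrite !mxE; apply: eq_bigr => k _; rewrite XE.
  rewrite KAE mxE; apply: eq_bigr => a _.
  rewrite mxE [RHS]mxE (bigD1 (c b)) //=.
  rewrite big1 ?addr0 => [|l /negPf lc]; last by rewrite !mxE lc mul0r mulr0.
  rewrite !mxE eqxx mul1r; congr (_ * _).
  by apply: eq_bigr => k _; rewrite [B _ _ _]mxE.
rewrite -[r0 in X in (_ <= X)%N]vr0 -[in X in (_ <= X)%N]mxrank_tr.
apply: mxrank_sum_le => a; apply: leq_trans (mxrankM_maxl _ _) _.
rewrite -ltnS prednK //; apply: leq_trans (Bq (f a)).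
have colS : B (f a) *m \col_l v l = col (f a) (S v).
  apply/matrixP => i j; rewrite !mxE summxE.
  by apply: eq_bigr => l _; rewrite !mxE mulrC.
(* If no rank were lost, [B (f a)] would be a left multiple of [K *m B (f a)], and column [f a] of
   [S v] would vanish, against the independence of the columns [f]. *)
rewrite ltn_neqAle mxrankM_maxr andbT; apply/eqP => eq_rk.
have: (B (f a) <= K *m B (f a))%MS.
  by rewrite -(mxrank_leqif_sup (submxMl _ _)) eq_rk.
case/submxP => Z BZ; have col_eq0 : col (f a) (S v) = 0.
  by rewrite -colS BZ -(mulmxA Z) -(mulmxA K) colS colE (mulmxA K) mulmx_ker
    mul0mx mulmx0.
have /row_freeP[W /row_matrixP/(_ a)] := maxrowsub_free (S v)^T.
rewrite row_mul -/f row_rowsub -tr_col col_eq0 trmx0 mul0mx => /matrixP/(_ 0 a).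
by rewrite !mxE eqxx => /eqP; rewrite eq_sym oner_eq0.
Qed.

Lemma mxrank_mxsub (F : fieldType) (m n m' n' : nat) (f : 'I_m' -> 'I_m)
    (g : 'I_n' -> 'I_n) (A : 'M[F]_(m, n)) :
  (\rank (mxsub f g A) <= \rank A)%N.
Proof.
have -> : mxsub f g A = rowsub f 1%:M *m A *m colsub g 1%:M.
  by rewrite -rowsubE mulmx_colsub mulmx1; apply/matrixP => i j; rewrite !mxE.
exact: leq_trans (mxrankM_maxl _ _) (mxrankM_maxr _ _).
Qed.

(** * Contractions of a tensor with vectors *)

Lemma sum_midx_prod (F : fieldType) (k : nat) (n : 'I_k -> nat)
    (f : forall l : 'I_k, 'I_(n l) -> F) :
  \sum_(x : midx n) \prod_l f l (x l) = \prod_l \sum_c f l c.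
Proof.
pose A l : 'M[F]_(1, n l) := \row_c f l c.
pose y := [ffun=> ord0] : midx (fun _ : 'I_k => 1%N).
have /ffunP/(_ y) := tmap_pure A (fun l => const_mx 1).
rewrite ffunE [RHS]ffunE => E.
transitivity (\prod_l (A l *m const_mx 1 : 'cV_1) (y l) 0).
  rewrite -E; apply: eq_bigr => x _; rewrite ffunE [X in _ * X]big1 ?mulr1.
    by apply: eq_bigr => l _; rewrite mxE.
  by move=> l _; rewrite mxE.
by apply: eq_bigr => l _; rewrite mxE; apply: eq_bigr => c _; rewrite !mxE mulr1.
Qed.

Definition contract (F : fieldType) (k : nat) (n : 'I_k -> nat) (T : tensor F n)
    (phi : forall l : 'I_k, 'I_(n l) -> F) : F :=
  \sum_(z : midx n) (\prod_l phi l (z l)) * T z.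

Definition delta (F : fieldType) (d : nat) (c : 'I_d) : 'I_d -> F :=
  fun u => (u == c)%:R.

Lemma sum_delta (F : fieldType) (d : nat) (f : 'I_d -> F) (c : 'I_d) :
  \sum_u f u * delta F u c = f c.
Proof.
rewrite (bigD1 c) //= /delta eqxx mulr1 big1 ?addr0 // => u /negPf uc.
by rewrite eq_sym uc mulr0.
Qed.

Section Contract.

Variables (F : fieldType) (k : nat) (n : 'I_k -> nat) (T : tensor F n).
Implicit Types (phi psi w : forall l : 'I_k, 'I_(n l) -> F) (x y : midx n).
Implicit Types (P Q : {set 'I_k}).

Lemma eq_contract phi psi :
  (forall l, phi l =1 psi l) -> contract T phi = contract T psi.
Proof.
move=> eq_phi; apply: eq_bigr => z _; congr (_ * _).
by apply: eq_bigr => l _; apply: eq_phi.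
Qed.

Lemma contract_subst phi psi (g : forall l, 'I_(n l) -> 'I_(n l) -> F) :
  (forall l u, phi l u = \sum_c psi l c * g l c u) ->
  contract T phi =
  \sum_(z : midx n) (\prod_l psi l (z l)) * contract T (fun l => g l (z l)).
Proof.
move=> phiE; rewrite /contract.
under [RHS]eq_bigr => z _ do rewrite mulr_sumr.
rewrite exchange_big; apply: eq_bigr => u _ /=.
under [RHS]eq_bigr => z _ do rewrite mulrA -big_split.
rewrite -mulr_suml; congr (_ * _).
rewrite (sum_midx_prod (fun l c => psi l c * g l c (u l))).
by apply: eq_bigr => l _; apply: phiE.
Qed.

Lemma contract_leg (j : 'I_k) phi (psi : 'I_(n j) -> forall l, 'I_(n l) -> F) :
  (forall c, psi c j =1 delta F c) ->
  (forall c l, l != j -> psi c l =1 phi l) ->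
  contract T phi = \sum_c phi j c * contract T (psi c).
Proof.
move=> psij psil; rewrite /contract.
under [RHS]eq_bigr => c _ do rewrite mulr_sumr.
rewrite exchange_big; apply: eq_bigr => u _ /=.
under [RHS]eq_bigr => c _ do rewrite mulrA.
rewrite -mulr_suml; congr (_ * _); rewrite (bigD1 j) //=.
rewrite -{1}(sum_delta (phi j)) mulr_suml; apply: eq_bigr => c _.
rewrite [in RHS](bigD1 j) //= mulrA psij; congr (_ * _).
by apply: eq_bigr => l lj; rewrite psil.
Qed.

(* The flattening P vs Q of the contraction of [T] with [w] in the legs outside
   P and Q. Its rows and columns are indexed by full multi-indices, of which
   only the components in P, resp. Q, matter; the repetitions do not change the
   rank and avoid dependent types. *)
Definition legs P Q w x y : forall l, 'I_(n l) -> F := fun l =>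
  if l \in P then delta F (x l) else if l \in Q then delta F (y l) else w l.

Definition cflat P Q w : 'M[F]_#|midx n| :=
  \matrix_(a, b) contract T (legs P Q w (enum_val a) (enum_val b)).

Lemma cflat_tr P Q w : [disjoint P & Q] -> (cflat P Q w)^T = cflat Q P w.
Proof.
move=> PQ; apply/matrixP => a b; rewrite !mxE; apply: eq_contract => l u.
by rewrite /legs; case: ifP => // /(disjointFr PQ) ->.
Qed.

(** Contracting further legs of [Q] only combines columns. *)
Lemma mxrank_cflat_sub P Q Q' w w' :
  Q' \subset Q -> (forall l, l \notin Q -> w' l =1 w l) ->
  (\rank (cflat P Q' w') <= \rank (cflat P Q w))%N.
Proof.
move=> sQ eqw.
pose psi y l :=
  if [&& l \notin P, l \in Q & l \notin Q'] then w' l else delta F (y l).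
have sum_delta' l (a : 'I_(n l)) (X : F) : \sum_c delta F a c * X = X.
  rewrite -mulr_suml (bigD1 a) //= /delta eqxx big1 ?addr0 ?mul1r //.
  by move=> c /negPf ->.
have -> : cflat P Q' w' =
   cflat P Q w *m \matrix_(c, b)
     \prod_l psi (enum_val b) l ((enum_val c : midx n) l).
  apply/matrixP => a b; rewrite !mxE.
  pose x : midx n := enum_val a; pose y : midx n := enum_val b.
  rewrite (contract_subst (psi := psi y) (g := fun l c =>
     if l \in P then delta F (x l) else if l \in Q then delta F c else w l)).
    rewrite (reindex _ (onW_bij _ (enum_val_bij _))) /=.
    by apply: eq_bigr => c _; rewrite !mxE mulrC.
  move=> l u; rewrite /legs /psi; case: ifP => lP /=.
    by rewrite sum_delta'.
  case: (boolP (l \in Q)) => lQ /=; last first.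
    by rewrite sum_delta' (contraNF (fintype.subsetP sQ l) lQ) eqw.
  by case: (l \in Q') => /=; rewrite sum_delta.
exact: mxrankM_maxl.
Qed.

(** Induction on [#|Q|] through [mxrank_slices]. The bound [q j] is asked only for ranks below
    [size e], so that it can itself come from an application of this lemma. *)
Lemma mxrank_cflat_prod P (q : 'I_k -> nat) (e : seq F) Q w :
  uniq e -> [disjoint P & Q] -> (\rank (cflat P Q w) < size e)%N ->
  (forall j w', j \in Q -> \rank (cflat P [set j] w') < size e ->
     \rank (cflat P [set j] w') <= q j)%N ->
  (\rank (cflat P Q w) <= \prod_(j in Q) q j)%N.
Proof.
move=> e_uniq; have [N leQN] := ubnP #|Q|; elim: N => // N IH in Q w leQN *.
move=> PQ lt_e qP; have [Q0|[j jQ]] := set_0Vmem Q.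
  (* All columns are equal, so the rank is at most 1, the empty product. *)
  rewrite Q0 big_set0.
  have -> : cflat P finset.set0 w =
      (\col_a contract T (legs P finset.set0 w (enum_val a) (enum_val a)))
      *m const_mx 1.
    apply/matrixP => a b; rewrite !mxE big_ord1 !mxE mulr1.
    by apply: eq_contract => l u; rewrite /legs !inE.
  exact: leq_trans (mxrankM_maxr _ _) (rank_leq_row _).
have jP : (j \in P) = false by rewrite (disjointFl PQ).
pose upd w (v : 'I_(n j) -> F) := @dfwith _ (fun l => 'I_(n l) -> F) w j v.
rewrite (big_setD1 j) //= mulnC.
(* Here U is [P], V is the leg [j], and W groups the other legs of [Q]. *)
apply: (mxrank_slices (A := fun c => cflat P (Q :\ j) (upd w (delta F c)))
   (c := fun b => (enum_val b : midx n) j) (s := id) _ _ _ e_uniq lt_e).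
- move=> a b; rewrite !mxE; apply: eq_contract => l u; rewrite /legs !inE.
  have [lj|lj] := eqVneq l j; first by subst l; rewrite jP jQ /upd dfwith_in.
  by rewrite /upd dfwith_out 1?eq_sym.
- move=> v; have -> : \sum_c v c *: cflat P (Q :\ j) (upd w (delta F c))
      = cflat P (Q :\ j) (upd w v).
    apply/matrixP => a b; rewrite summxE mxE.
    rewrite (contract_leg (j := j) (psi := fun c =>
       legs P (Q :\ j) (upd w (delta F c)) (enum_val a) (enum_val b))).
    + apply: eq_bigr => c _; rewrite !mxE {2}/legs !inE jP eqxx /=.
      by rewrite /upd dfwith_in.
    + by move=> c u; rewrite /legs !inE jP eqxx /= /upd dfwith_in.
    + move=> c l lj u; rewrite /legs /upd !dfwith_out // eq_sym //.
  have le_rk : (\rank (cflat P (Q :\ j) (upd w v)) <= \rank (cflat P Q w))%N.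
    apply: mxrank_cflat_sub; first exact: subD1set.
    by move=> l lQ u; rewrite /upd dfwith_out //; apply: contraNneq lQ => <-.
  apply: IH.
  + by move: leQN; rewrite (cardsD1 j Q) jQ.
  + by apply: disjointWr PQ; apply: subD1set.
  + exact: leq_ltn_trans lt_e.
  + by move=> j' w'; rewrite inE => /andP[_]; apply: qP.
(* Fixing column [b] contracts the legs of W with the basis vectors given by [y]; what remains is a
   flattening of [P] against [j]. *)
move=> b; pose y : midx n := enum_val b.
pose w' l := if l \in Q then delta F (y l) else w l.
pose yj (c : 'I_(n j)) : midx n :=
  [ffun l => @dfwith _ (fun l => 'I_(n l)) y j c l].
apply: leq_trans (_ : \rank (cflat P [set j] w') <= _)%N.
  have -> : \matrix_(a, c) cflat P (Q :\ j) (upd w (delta F c)) a b =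
      mxsub id (fun c => enum_rank (yj c)) (cflat P [set j] w').
    apply/matrixP => a c; rewrite !mxE enum_rankK; apply: eq_contract => l u.
    rewrite /legs !inE /w' /yj ffunE; have [lj|lj] := eqVneq l j.
      by subst l; rewrite jP /upd !dfwith_in.
    by rewrite /upd !dfwith_out // eq_sym.
  exact: mxrank_mxsub.
apply: qP => //; apply: leq_ltn_trans lt_e; apply: mxrank_cflat_sub.
  by rewrite finset.sub1set.
by move=> l /negPf lQ u; rewrite /w' lQ.
Qed.

End Contract.

(** * Contractions to two legs and the subrank *)

Lemma mxrank_pairing (F : fieldType) (m n : nat) (M : 'M[F]_(m, n)) :
  exists L R, L *m M *m R = 1%:M :> 'M_(\rank M).
Proof.
have /row_freeP[R MR] := row_base_free M.
by exists (row_base M *m pinvmx M), R; rewrite mulmxKpV ?eq_row_base.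
Qed.

Lemma pair_tensorE (F : fieldType) (k : nat) (i j : 'I_k) (r : nat)
    (y : midx (pair_dim i j r)) :
  i != j -> pair_tensor F i j r y = (y i == y j :> nat)%:R.
Proof.
move=> ij; rewrite /pair_tensor sum_ffunE.
have yi : (y i < r)%N.
  by have := ltn_ord (y i); rewrite [X in (_ < X)%N]/pair_dim eqxx.
rewrite (bigD1 (Ordinal yi)) //= big1 ?addr0 => [|c ci]; last first.
  rewrite ffunE (bigD1 i) //= mxE eqxx /=.
  have -> : (y i == c :> nat) = false.
    by apply: contraNF ci => /eqP yc; apply/eqP/val_inj.
  by rewrite mul0r.
rewrite ffunE (bigD1 i) //= (bigD1 j) 1?eq_sym //= big1 ?mulr1.
  by rewrite !mxE !eqxx orbT mul1r eq_sym.
move=> l /andP[/negPf li /negPf lj]; rewrite mxE li lj /=.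
have := ltn_ord (y l); rewrite [X in (_ < X)%N]/pair_dim li lj /=.
by rewrite ltnS leqn0 => ->.
Qed.

(** The contraction is a bilinear form [M] on the legs [i] and [j], which [L] and [R] bring to an
    identity of size [\rank M]. With the vectors [w] as one-row matrices in the other legs, they
    give a restriction of [T]. *)
Lemma mxrank_cflat_subrank (F : fieldType) (k : nat) (n : 'I_k -> nat)
    (T : tensor F n) (i j : 'I_k) (w : forall l : 'I_k, 'I_(n l) -> F) :
  i != j -> (\rank (cflat T [set i] [set j] w) <= subrank i j T)%N.
Proof.
move=> ij; have ji : j != i by rewrite eq_sym.
pose with_ij (u : 'I_(n i) -> F) (v : 'I_(n j) -> F) :=
  @dfwith _ (fun l => 'I_(n l) -> F)
    (@dfwith _ (fun l => 'I_(n l) -> F) w j v) i u.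
have with_i u v : with_ij u v i = u by rewrite /with_ij dfwith_in.
have with_j u v : with_ij u v j = v by rewrite /with_ij dfwith_out // dfwith_in.
have with_out u v l : l != i -> l != j -> with_ij u v l = w l.
  by move=> li lj; rewrite /with_ij !dfwith_out // eq_sym.
pose M := \matrix_(a, b) contract T (with_ij (delta F a) (delta F b)).
have contractM u v :
    contract T (with_ij u v) = \sum_a \sum_b u a * M a b * v b.
  rewrite (@contract_leg _ _ _ T i _ (fun a => with_ij (delta F a) v)).
  - apply: eq_bigr => a _; rewrite with_i.
    rewrite (@contract_leg _ _ _ T j _
      (fun b => with_ij (delta F a) (delta F b))).
    + rewrite mulr_sumr; apply: eq_bigr => b _.
      by rewrite with_j mxE -mulrA; congr (_ * _); rewrite mulrC.
    + by move=> b c; rewrite with_j.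
    + move=> b l lj c; have [li|li] := eqVneq l i; last by rewrite !with_out.
      by subst l; rewrite !with_i.
  - by move=> a c; rewrite with_i.
  - move=> a l li c; have [lj|lj] := eqVneq l j; last by rewrite !with_out.
    by subst l; rewrite !with_j.
apply: (@leq_trans (\rank M)).
  rewrite (_ : cflat _ _ _ _ = mxsub (fun x => (enum_val x : midx n) i)
    (fun y => (enum_val y : midx n) j) M) ?mxrank_mxsub //.
  apply/matrixP => x y; rewrite !mxE; apply: eq_contract => l u.
  rewrite /legs !inE; have [li|li] := eqVneq l i.
    by subst l; rewrite with_i.
  by have [lj|lj] := eqVneq l j; [subst l; rewrite with_j | rewrite with_out].
apply: (subrankP T ij).2; have [L [R LMR]] := mxrank_pairing M.
(* One formula covers all legs, whence indices in [nat]; the default 0 is not met in legs [i] and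
   [j], where indices stay below [\rank M]. *)
pose rowL (a : nat) c := if insub a is Some a' then L a' c else 0.
pose colR (b : nat) c := if insub b is Some b' then R c b' else 0.
pose d := pair_dim i j (\rank M).
exists (fun l => \matrix_(a < d l, c < n l) with_ij (rowL a) (colR a) l c).
apply/ffunP => y; rewrite pair_tensorE //.
have yi : (y i < \rank M)%N.
  by have := ltn_ord (y i); rewrite [X in (_ < X)%N]/pair_dim eqxx.
have yj : (y j < \rank M)%N.
  by have := ltn_ord (y j); rewrite [X in (_ < X)%N]/pair_dim eqxx orbT.
transitivity (contract T (with_ij (rowL (y i)) (colR (y j)))); last first.
  rewrite ffunE; apply: eq_bigr => x _; congr (_ * _).
  apply: eq_bigr => l _; rewrite mxE; have [li|li] := eqVneq l i.
    by subst l; rewrite !with_i.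
  have [lj|lj] := eqVneq l j; last by rewrite !with_out.
  by subst l; rewrite !with_j.
rewrite contractM /rowL /colR (insubT (fun a => a < _)%N yi)
  (insubT (fun a => a < _)%N yj) /=.
have /matrixP/(_ (Ordinal yi) (Ordinal yj)) := LMR; rewrite mxE [RHS]mxE => <-.
rewrite exchange_big; apply: eq_bigr => b _; rewrite -mulr_suml; congr (_ * _).
by rewrite mxE.
Qed.

(** * Field size, flattening rank and conclusion *)

Lemma card_le_uniq_seq (T : choiceType) (N : nat) :
  (`I_N #<= [set: T])%card -> exists2 s : seq T, uniq s & size s = N.
Proof.
move=> /card_leP[f].
pose g (a : 'I_N) : `I_N := SigSub (mem_set (ltn_ord a : `I_N a)).
exists [seq \val (f (g a)) | a : 'I_N].
  rewrite map_inj_uniq ?enum_uniq // => a b.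
  move=> /val_inj /(inj (mem_setT _) (mem_setT _)).
  by move=> /(congr1 \val) /= /val_inj.
by rewrite size_map size_enum_ord.
Qed.

Lemma contract_delta (F : fieldType) (k : nat) (n : 'I_k -> nat)
    (T : tensor F n) (z : midx n) : contract T (fun l => delta F (z l)) = T z.
Proof.
rewrite /contract (bigD1 z) //= big1 ?mul1r => [|l _]; last first.
  by rewrite /delta eqxx.
rewrite big1 ?addr0 // => x xz.
case: (pickP (fun l => x l != z l)) => [l xzl|xz0].
  by rewrite (bigD1 l) //= /delta (negPf xzl) !mul0r.
by case/eqP: xz; apply/ffunP => l; apply/eqP/negbFE/xz0.
Qed.

(** Restricting and merging multi-indices exhibits each matrix as a selection of rows and columns of
    the other. *)
Lemma flattening_rank_cflat (F : fieldType) (k : nat) (n : 'I_k -> nat)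
    (I : {set 'I_k}) (T : tensor F n) (w : forall l : 'I_k, 'I_(n l) -> F) :
  flattening_rank I T = \rank (cflat T I (~: I) w).
Proof.
pose res (J : {set 'I_k}) (x : midx n) : pidx n J := [ffun l => x (val l)].
have cflatE (x y : midx n) :
    contract T (legs I (~: I) w x y) =
    T (merge_idx (res I x) (res (~: I) y)).
  rewrite -contract_delta; apply: eq_contract => l u; rewrite /legs inE.
  rewrite ffunE; case: in_or_inC => lI; rewrite ffunE /=; first by rewrite lI.
  by have := lI; rewrite inE => /negPf->.
apply/eqP; rewrite eqn_leq; apply/andP; split; last first.
  rewrite (_ : cflat T I (~: I) w = mxsub (fun x => enum_rank (res I (enum_val x)))
      (fun y => enum_rank (res (~: I) (enum_val y))) (flattening I T)).
    exact: mxrank_mxsub.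
  by apply/matrixP => x y; rewrite !mxE cflatE !enum_rankK.
(* Merging needs a fixed partial index on either side; if there is none, the flattening is empty. *)
case: (pickP 'I_#|pidx n I|) => [a0 _|no_row]; last first.
  rewrite /flattening_rank (_ : flattening I T = 0) ?mxrank0 //.
  by apply/matrixP => a; have := no_row a.
case: (pickP 'I_#|pidx n (~: I)|) => [b0 _|no_col]; last first.
  rewrite /flattening_rank (_ : flattening I T = 0) ?mxrank0 //.
  by apply/matrixP => a b; have := no_col b.
pose u0 : pidx n I := enum_val a0; pose v0 : pidx n (~: I) := enum_val b0.
have resl u v : res I (merge_idx u v) = u.
  by apply/ffunP => l; rewrite ffunE merge_idx_in.
have resr u v : res (~: I) (merge_idx u v) = v.
  by apply/ffunP => l; rewrite ffunE merge_idx_notin.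
rewrite /flattening_rank (_ : flattening I T = mxsub
    (fun a => enum_rank (merge_idx (enum_val a) v0))
    (fun b => enum_rank (merge_idx u0 (enum_val b))) (cflat T I (~: I) w)).
  exact: mxrank_mxsub.
by apply/matrixP => a b; rewrite !mxE !enum_rankK cflatE resl resr.
Qed.

Local Close Scope ring_scope.

(* `I_r.+1 #<= [set: F] says that F has at least r + 1 elements, that is,
   |F| > r, with F finite or infinite. *)
Theorem theorem3p2 (F : fieldType) (k : nat) (n : 'I_k -> nat)
    (I : {set 'I_k}) (T : tensor F n) :
  1 <= #|I| <= k - 1 ->
  (`I_(flattening_rank I T).+1 #<= [set: F]%classic)%card ->
  flattening_rank I T <= \prod_(i in I) \prod_(j in ~: I) subrank i j T.
Proof.
move=> _ /card_le_uniq_seq[e e_uniq sz_e]; pose w l : 'I_(n l) -> F := fun=> 0%R.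
(* Legs [j] outside [I] are split off first, each bounded by a product over [I]; after transposing,
   the legs of [I] are split off against [j] alone. *)
rewrite exchange_big /=; move: sz_e; rewrite (flattening_rank_cflat I T w) => sz_e.
apply: (mxrank_cflat_prod e_uniq); rewrite ?sz_e //.
  by rewrite -setI_eq0 finset.setICr.
move=> j w1 jI lt1.
have disj : [disjoint I & [set j]].
  by rewrite disjoint_sym disjoints1 -finset.in_setC.
rewrite -mxrank_tr cflat_tr // in lt1 *.
apply: (mxrank_cflat_prod e_uniq); rewrite ?sz_e 1?disjoint_sym //.
move=> i w2 iI _; have ij : i != j by apply: contraTneq jI => <-; rewrite inE iI.
rewrite -mxrank_tr cflat_tr ?mxrank_cflat_subrank //.
by rewrite disjoints1 inE eq_sym.
Qed.
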